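(* There is an integer $m_0$ such that for all integers $m\ge m_0$ one has \[ A(2m-1,m-1) - 2A(2m-1,m-2) + A(2m-1,m-3) < 0 . \]
   Context: For integers $0\le j<i$, the Eulerian number $A(i,j)$ is the number of permutations of a set with $i$ (ordered) elements having exactly $j$ ascents; explicitly $A(i,j) = \sum_{k=0}^{j+1} (-1)^k \binom{i+1}{k}(j+1-k)^i$. *)

(* Defs.v *)
From mathcomp Require Import all_boot all_order all_fingroup all_algebra.

Set Implicit Arguments.
Unset Strict Implicit.
Unset Printing Implicit Defensive.

(* One-line notation [s 0, s 1, ..., s (n-1)]: an ascent is a position [i],
   not the last one, such that [s i < s (i + 1)]. *)
Definition ascents (n : nat) (s : 'S_n) : {set 'I_n} :=
  [set i : 'I_n | [exists j : 'I_n, (j == i.+1 :> nat) && (s i < s j)]].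

Definition eulerian (n k : nat) : nat :=
  #|[set s : 'S_n | #|ascents s| == k]|.

(* Main.v *)
(* Insertion of the maximum gives A(n+1,k) = (k+1) A(n,k) + (n+1-k) A(n,k-1).
   Applied twice, and with the symmetry of each row, it expresses the central
   entries e, f, g of row 2M-1 in terms of those of row 2M-3.  Let d0, d1, d2 >= 0
   be the successive differences of row 2M-3 going down from the centre.  Row
   2M-1 has first difference (M^2-1) d0 + (M+1)^2 d1 and second one
   (M-1)^2 d0 + (2M^2-5) d1 + (M+2)^2 d2, so the ratio of the second to the first
   is at least (M-1)/(M+1), whatever d0, d1, d2.  The quantity to be proved
   negative is 2(M-1) d0 - (M^2-2M-6) d1 - (M+2)^2 d2, which for M >= 6 follows
   from that bound on d1/d0 in the preceding row. *)
Require Import Defs.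
From mathcomp Require Import all_boot all_order all_fingroup all_algebra.
From mathcomp Require Import zify ring.

Set Implicit Arguments.
Unset Strict Implicit.
Unset Printing Implicit Defensive.

Import Order.TTheory GRing.Theory Num.Theory.

(** * Ascents of a word after insertion of its maximum *)

Definition asc (w : nat -> nat) (n : nat) : nat :=
  \sum_(i < n) (w i < w i.+1).

Lemma eq_asc (w v : nat -> nat) (n : nat) :
  (forall i, i <= n -> w i = v i) -> asc w n = asc v n.
Proof.
by move=> wv; apply: eq_bigr => i _; rewrite !wv // ltnW.
Qed.

Definition insert_at (p M : nat) (w : nat -> nat) (i : nat) : nat :=
  if i < p then w i else if i == p then M else w i.-1.

(* Inserting the maximum [M] at position [p] creates the ascent ending at [p]
   (if [0 < p]) and destroys the ascent [w (p-1) < w p], if there was one. *)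
Definition keeps_asc (w : nat -> nat) (n p : nat) : bool :=
  (p == 0) || (p <= n) && (w p.-1 < w p).

Lemma asc_insert_at (w : nat -> nat) (M n p : nat) :
    (forall i, i <= n -> w i < M) -> p <= n.+1 ->
  asc (insert_at p M w) n.+1 = asc w n + ~~ keeps_asc w n p.
Proof.
elim: n => [|n IHn] w_lt.
  case: p => [|[|//]] _; rewrite /asc big_ord_recr !big_ord0 /insert_at /=.
    by rewrite ltnNge ltnW ?w_lt.
  by rewrite w_lt.
have {}IHn := IHn (fun i le_in => w_lt i (leqW le_in)).
(* The maximum lands last, just before the last letter, or further left; only in the third case is
   the final comparison that of [w], so that induction applies. *)
rewrite leq_eqVlt ltnS => /predU1P[->|].
  rewrite /asc big_ord_recr /=; congr (_ + _).
    apply: eq_asc => i le_in; rewrite /insert_at; case: ltnP => //; lia.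
  by rewrite /insert_at /keeps_asc !ltnn !eqxx leqnn w_lt //=.
rewrite leq_eqVlt ltnS => /predU1P[->|le_pn].
  rewrite /asc !big_ord_recr /= -/(asc w n).
  have -> : \sum_(i < n) (insert_at n.+1 M w i < insert_at n.+1 M w i.+1)
      = asc w n.
    apply: eq_asc => i le_in; rewrite /insert_at; case: ltnP => //; lia.
  rewrite /insert_at /keeps_asc /= !ltnn !eqxx !leqnn (ltnNge n.+2) leqnSn /=.
  rewrite (gtn_eqF (ltnSn n.+1)) w_lt // (ltnNge M) ltnW ?w_lt //.
  by case: ltnP; lia.
rewrite /asc big_ord_recr /= -/(asc _ n.+1) IHn; last by lia.
rewrite [in RHS]big_ord_recr /= -/(asc w n) addnAC; congr (_ + _ + _).
  rewrite /insert_at !(ltnNge _ p) (leqW le_pn) (leqW (leqW le_pn)) /=.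
  by rewrite !gtn_eqF //; lia.
by rewrite /keeps_asc le_pn (leqW le_pn).
Qed.

(** The positions counted are the front and the gap inside each ascent. *)
Lemma sum_keeps_asc (w : nat -> nat) (n : nat) :
  \sum_(p < n.+2) keeps_asc w n p = (asc w n).+1.
Proof.
rewrite big_ord_recl big_ord_recr /keeps_asc /= ltnn addn0 add1n.
congr _.+1; apply: eq_bigr => i _.
by rewrite ltn_ord.
Qed.

(** * Permutations as words *)

Definition one_line (n : nat) (s : 'S_n.+1) (i : nat) : nat := s (inord i).

Lemma card_ascents (n : nat) (s : 'S_n.+1) :
  #|ascents s| = asc (one_line s) n.
Proof.
rewrite -sum1_card big_mkcond big_ord_recr /= [X in _ + X](_ : _ = 0).
  rewrite addn0; apply: eq_bigr => i _; rewrite inE /one_line.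
  have -> : widen_ord (leqnSn n) i = inord i :> 'I_n.+1.
    by apply: val_inj; rewrite /= inordK // ltnW // ltnS.
  have -> : [exists j : 'I_n.+1, (j == (inord i : 'I_n.+1).+1 :> nat)
             && (s (inord i) < s j)] = (s (inord i) < s (inord i.+1)).
    have i1 : (inord i.+1 : 'I_n.+1) = i.+1 :> nat by rewrite inordK // ltnS.
    have i0 : (inord i : 'I_n.+1) = i :> nat by rewrite inordK // ltnW // ltnS.
    apply/existsP/idP => [[j /andP[/eqP ji]]|lt_s].
      by rewrite (_ : j = inord i.+1) //; apply: val_inj; rewrite /= ji i0 i1.
    by exists (inord i.+1); rewrite i0 i1 eqxx.
  by case: ifP.
rewrite inE; case: ifP => // /existsP[j /andP[/eqP]] /=.
by have := ltn_ord j; lia.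
Qed.

Lemma one_line_lift_perm (n : nat) (p : 'I_n.+2) (s : 'S_n.+1) (i : nat) :
  i <= n.+1 ->
  one_line (lift_perm p ord_max s) i = insert_at p n.+1 (one_line s) i.
Proof.
move=> le_i; rewrite /one_line /insert_at.
case: (unliftP p (inord i)) => [j|] def_i.
  have def_i' : i = bump p j by rewrite -[LHS](@inordK n.+1) ?def_i.
  rewrite def_i lift_perm_lift /= /bump leqNgt ltn_ord add0n def_i' /bump.
  case: (leqP p j) => /= le_pj.
    rewrite add1n /= ltnNge leqW //= gtn_eqF ?ltnS //.
    by rewrite (_ : inord j = j) //; apply: val_inj; rewrite /= inordK.
  rewrite add0n le_pj.
  by rewrite (_ : inord j = j) //; apply: val_inj; rewrite /= inordK.
have -> : i = p by rewrite -def_i inordK.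
rewrite ltnn eqxx (_ : inord p = p) ?lift_perm_id //.
by apply: val_inj; rewrite /= inordK.
Qed.

(** Injectivity: [p] is recovered as the preimage of the maximum, then [s] by deleting it. Both
    sides have (n+2)! elements. *)
Lemma lift_perm_max_bij (n : nat) :
  bijective (fun ps : 'I_n.+2 * 'S_n.+1 => lift_perm ps.1 ord_max ps.2).
Proof.
apply: inj_card_bij => [[p s] [q t] /= eq_pq|].
  have pq : p = q.
    by apply: (@perm_inj _ (lift_perm p ord_max s)); rewrite [in RHS]eq_pq !lift_perm_id.
  rewrite -pq in eq_pq *; congr (_, _); apply/permP => i.
  by apply: (@lift_inj _ ord_max); rewrite -!(lift_perm_lift p) eq_pq.
by rewrite card_prod !card_Sn card_ord.
Qed.

(** * Recurrence, symmetry and monotonicity of the rows *)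

Lemma eulerianE (n k : nat) :
  eulerian n k = \sum_(s : 'S_n) (#|ascents s| == k).
Proof.
by rewrite /eulerian -sum1_card big_mkcond; apply: eq_bigr => s _; rewrite inE; case: eqP.
Qed.

Lemma card_ascents_lift_perm (n : nat) (p : 'I_n.+2) (s : 'S_n.+1) :
  #|ascents (lift_perm p ord_max s)|
    = #|ascents s| + ~~ keeps_asc (one_line s) n p.
Proof.
rewrite !card_ascents (eq_asc (@one_line_lift_perm n p s)) asc_insert_at //.
 - by move=> i _; apply: ltn_ord.
 - exact: leq_ord.
Qed.

Lemma card_ascents_le (n : nat) (s : 'S_n.+1) : #|ascents s| <= n.
Proof.
rewrite card_ascents -[leqRHS]card_ord -sum1_card.
by apply: leq_sum => i _; case: (_ < _).
Qed.

(** Of the n+2 insertion positions in a permutation with a ascents, a+1 keep the number of ascents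
    and n+1-a raise it by one. *)
Lemma eulerianSS (n k : nat) :
  eulerian n.+2 k = k.+1 * eulerian n.+1 k
     + (if k is j.+1 then (n.+1 - j) * eulerian n.+1 j else 0).
Proof.
have -> : (if k is j.+1 then (n.+1 - j) * eulerian n.+1 j else 0)
    = \sum_(s : 'S_n.+1) (n.+1 - #|ascents s|) * (#|ascents s|.+1 == k).
  case: k => [|j]; first by rewrite big1 // => s _; rewrite muln0.
  rewrite eulerianE big_distrr; apply: eq_bigr => s _ /=.
  by rewrite eqSS; case: eqP => [->|]; rewrite ?muln0.
rewrite !eulerianE big_distrr -big_split.
rewrite (reindex _ (onW_bij _ (@lift_perm_max_bij n))) -(pair_bigA _
  (fun p s => nat_of_bool (#|ascents (lift_perm p ord_max s)| == k))) exchange_big.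
apply: eq_bigr => s _ /=.
set a := #|ascents s|.
rewrite (eq_bigr (fun p : 'I_n.+2 => keeps_asc (one_line s) n p * (a == k)
  + (1 - keeps_asc (one_line s) n p) * (a.+1 == k))); last first.
  move=> p _; rewrite card_ascents_lift_perm -/a.
  by case: keeps_asc; rewrite ?addn0 ?addn1 /=; lia.
rewrite big_split -!big_distrl /= sumnB; last by move=> p _; case: keeps_asc.
rewrite sum_keeps_asc -card_ascents -/a sum1_card card_ord subSS.
by case: (a =P k) => [->|]; lia.
Qed.

Lemma eulerian_oversize (n k : nat) : n < k -> eulerian n.+1 k = 0.
Proof.
move=> lt_nk; rewrite eulerianE big1 // => s _.
by have := card_ascents_le s; case: eqP => // ->; lia.
Qed.

Lemma eulerian0 (n : nat) : eulerian n.+1 0 = 1.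
Proof.
elim: n => [|n IHn]; last by rewrite eulerianSS IHn.
rewrite eulerianE (eq_bigr (fun=> 1)) ?sum1_card ?card_Sn // => s _.
by have := card_ascents_le s; rewrite leqn0 => ->.
Qed.

(** By induction: the reflection exchanges the two terms of the recurrence. *)
Lemma eulerian_sym (n k : nat) :
  k <= n -> eulerian n.+1 (n - k) = eulerian n.+1 k.
Proof.
elim: n k => [|n IHn] [|k] //=; first last.
- rewrite ltnS => le_kn; rewrite subSS.
  have [->|ne_kn] := eqVneq k n.
    rewrite subnn eulerian0 eulerianSS eulerian_oversize // muln0 add0n subSnn mul1n.
    by rewrite -(IHn n) // subnn eulerian0.
  have lt_kn : k < n by lia.
  have -> : n - k = (n - k.+1).+1 by lia.
  rewrite !eulerianSS IHn // (_ : (n - k.+1).+1 = n - k); last by lia.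
  have -> : (n.+1 - (n - k.+1) = k.+2)%N by lia.
  by rewrite IHn // -subSn // addnC.
- move=> _; rewrite subn0 eulerian0 eulerianSS eulerian_oversize //.
  by rewrite muln0 add0n subSnn mul1n -(IHn n) // subnn eulerian0.
Qed.

(* Otherwise unification tries to compute the cardinals. *)
#[local] Opaque eulerian.

Lemma eulerian_lt (n k : nat) :
  k.*2.+1 < n -> eulerian n.+1 k < eulerian n.+1 k.+1.
Proof.
elim: n k => // n IHn [|k] lt_kn.
  by rewrite eulerianSS [in X in _ < X]eulerianSS !eulerian0; lia.
have lt1 : eulerian n.+1 k < eulerian n.+1 k.+1 by apply: IHn; lia.
(* When n = 2k+3 the two entries are mirror images, hence equal; strictness then comes from
   [lt1]. *)
have le2 : eulerian n.+1 k.+1 <= eulerian n.+1 k.+2.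
  have [lt_kn'|le_nk] := ltnP k.+1.*2.+1 n; first by rewrite ltnW ?IHn.
  have -> : k.+2 = n - k.+1 by lia.
  by rewrite eulerian_sym; lia.
rewrite eulerianSS [in X in _ < X]eulerianSS.
have [r def_r] : exists r, n = r + k.*2 + 2 by exists (n - k.*2 - 2); lia.
have -> : n.+1 - k = r + k + 3 by lia.
have -> : n.+1 - k.+1 = r + k + 2 by lia.
nia.
Qed.

(** * Central entries of the odd rows *)

Local Open Scope ring_scope.

Lemma eulerian_two_step (n k : nat) : (k <= n)%N ->
  (eulerian n.+3 k.+2)%:Z =
    (k%:Z + 3) ^+ 2 * (eulerian n.+1 k.+2)%:Z
    + ((k%:Z + 3) * (n%:Z - k%:Z) + (n%:Z + 1 - k%:Z) * (k%:Z + 2))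
      * (eulerian n.+1 k.+1)%:Z
    + (n%:Z + 1 - k%:Z) ^+ 2 * (eulerian n.+1 k)%:Z.
Proof.
move=> le_kn; rewrite !eulerianSS !subSS subSn // !(PoszD, PoszM, intS) -subzn //.
by ring.
Qed.

(* [N = 2M-3]: row [2M-3] determines the three entries of row [2M-1] next to the centre;
   by symmetry the entry just right of the centre equals the one just left of it. *)
Lemma eulerian_central_step (q : nat) (M := q%:Z + 5) (N := (2 * q + 7)%N)
    (e := (eulerian N q.+3)%:Z) (f := (eulerian N q.+2)%:Z)
    (g := (eulerian N q.+1)%:Z) (h := (eulerian N q)%:Z) :
  [/\ (eulerian N.+2 q.+4)%:Z = 2 * M ^+ 2 * f + 2 * (M ^+ 2 - M) * e,
      (eulerian N.+2 q.+3)%:Z = (M + 1) ^+ 2 * g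
        + 2 * (M ^+ 2 - M - 1) * f + (M - 1) ^+ 2 * e
    & (eulerian N.+2 q.+2)%:Z = (M + 2) ^+ 2 * h
        + 2 * (M ^+ 2 - M - 4) * g + (M - 2) ^+ 2 * f].
Proof.
have symf : eulerian N q.+4 = eulerian N q.+2.
  by rewrite /N addnS -(@eulerian_sym _ q.+2) //; [congr eulerian|]; lia.
rewrite /e /f /g /h /M; rewrite /N addnS in symf *.
by split; rewrite eulerian_two_step ?symf; lia.
Qed.

Lemma eulerian_diff_ratio (q : nat) (N := (2 * q + 9)%N) :
  (q%:Z + 4) * ((eulerian N q.+4)%:Z - (eulerian N q.+3)%:Z)
    <= (q%:Z + 6) * ((eulerian N q.+3)%:Z - (eulerian N q.+2)%:Z).
Proof.
have [] := eulerian_central_step q.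
rewrite /N (_ : (2 * q + 9 = (2 * q + 7).+2)%N); last by lia.
move=> -> -> ->.
have lt_fe : (eulerian (2 * q + 7) q.+2 < eulerian (2 * q + 7) q.+3)%N.
  by rewrite addnS eulerian_lt //; lia.
have lt_gf : (eulerian (2 * q + 7) q.+1 < eulerian (2 * q + 7) q.+2)%N.
  by rewrite addnS eulerian_lt //; lia.
have lt_hg : (eulerian (2 * q + 7) q < eulerian (2 * q + 7) q.+1)%N.
  by rewrite addnS eulerian_lt //; lia.
set e := eulerian _ q.+3 in lt_fe *; set f := eulerian _ q.+2 in lt_fe lt_gf *.
set g := eulerian _ q.+1 in lt_gf lt_hg *; set h := eulerian _ q in lt_hg *.
have [d0 ->] : exists d0, e = (f + d0)%N by exists (e - f)%N; lia.
have [d1 ->] : exists d1, f = (g + d1)%N by exists (f - g)%N; lia.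
have [d2 ->] : exists d2, g = (h + d2)%N by exists (g - h)%N; lia.
rewrite !PoszD -subr_ge0.
set rhs := (X in 0 <= X).
(* The [d0] terms cancel; with M = q+5 what remains is (M+1) ((M^2-4) d1 + (M+2)^2 d2). *)
have -> : rhs = ((q * q * q + 16 * q * q + 81 * q + 126) * d1
   + (q + 6) * (q + 7) * (q + 7) * d2)%N%:Z; last by [].
by rewrite /rhs !(PoszD, PoszM); ring.
Qed.

(* With [3 <= m0] none of the natural-number subtractions below truncates. *)
Theorem proposition6p8 :
  exists2 m0 : nat, (3 <= m0)%N &
    forall m : nat, (m0 <= m)%N ->
      (eulerian (2 * m - 1) (m - 1))%:Z - 2 * (eulerian (2 * m - 1) (m - 2))%:Z
        + (eulerian (2 * m - 1) (m - 3))%:Z < 0 :> int.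
Proof.
exists 6 => // m le6m; have [q ->] : exists q, m = (q + 6)%N by exists (m - 6)%N; lia.
have -> : (2 * (q + 6) - 1 = (2 * q.+1 + 7).+2)%N by lia.
have -> : (q + 6 - 1 = q.+1.+4)%N by lia.
have -> : (q + 6 - 2 = q.+1.+3)%N by lia.
have -> : (q + 6 - 3 = q.+1.+2)%N by lia.
have [-> -> ->] := eulerian_central_step q.+1.
have := eulerian_diff_ratio q; rewrite (_ : (2 * q + 9 = 2 * q.+1 + 7)%N); last by lia.
have lt_fe : (eulerian (2 * q.+1 + 7) q.+3 < eulerian (2 * q.+1 + 7) q.+4)%N.
  by rewrite addnS eulerian_lt //; lia.
have lt_gf : (eulerian (2 * q.+1 + 7) q.+2 < eulerian (2 * q.+1 + 7) q.+3)%N.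
  by rewrite addnS eulerian_lt //; lia.
have lt_hg : (eulerian (2 * q.+1 + 7) q.+1 < eulerian (2 * q.+1 + 7) q.+2)%N.
  by rewrite addnS eulerian_lt //; lia.
set e := eulerian _ q.+4 in lt_fe *; set f := eulerian _ q.+3 in lt_fe lt_gf *.
set g := eulerian _ q.+2 in lt_gf lt_hg *; set h := eulerian _ q.+1 in lt_hg *.
(* The successors record that the first two differences are positive, which makes the final
   inequality strict. *)
have [d0 def_e] : exists d0, e = (f + d0.+1)%N by exists (e - f).-1; lia.
have [d1 def_f] : exists d1, f = (g + d1.+1)%N by exists (f - g).-1; lia.
have [d2 def_g] : exists d2, g = (h + d2)%N by exists (g - h)%N; lia.
rewrite def_e def_f def_g !(PoszD, intS) => ratio.
(* (q+6)/(q+4) is largest at q = 0, where it is 3/2. *)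
have {ratio} le_d : 2 * (1 + d0%:Z) <= 3 * (1 + d1%:Z).
  have {}ratio : (q%:Z + 4) * (1 + d0%:Z) <= (q%:Z + 6) * (1 + d1%:Z).
    by move: ratio; lia.
  rewrite -(@ler_pM2l _ (q%:Z + 4)) //; nia.
set M := q%:Z + 6.
set lhs := (X in X < 0).
have {lhs} -> : lhs = 2 * (M - 1) * (1 + d0%:Z)
    - (M ^+ 2 - 2 * M - 6) * (1 + d1%:Z) - (M + 2) ^+ 2 * d2%:Z.
  by rewrite /lhs /M; ring.
(* By [le_d] the first two terms sum to at most -(M^2-5M-3)(1+d1), and M^2-5M-3 is positive from M =
   6 on. *)
rewrite /M; nia.
Qed.
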